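(* Let $H=(V,\mathcal{E})$ be a hypergraph. Then every partial sub-hypergraph $H'$ of $H$ satisfies $\nu^*(H')=\tau^*(H')$ if and only if $H$ has no partial sub-hypergraph isomorphic to the tail hypergraph.
   Context: A hypergraph is a pair $H=(V,\mathcal{E})$ where $V$ is a set (possibly infinite) and $\mathcal{E}$ is a set of subsets of $V$ (edges, possibly infinite). A fractional matching is $f:\mathcal{E}\to\mathbb{R}_{\ge0}$ with $\sum_{E\ni v}f(E)\le1$ for every $v\in V$; its size is $|f|=\sum_{E\in\mathcal{E}}f(E)$. A fractional cover is $g:V\to\mathbb{R}_{\ge0}$ with $\sum_{v\in E}g(v)\ge1$ for every $E\in\mathcal{E}$; its size is $|g|=\sum_{v\in V}g(v)$. (Sums of nonnegative terms are suprema of finite partial sums and may be $\infty$.) $\nu^*(H)=\sup\{|f|\}$ over fractional matchings and $\tau^*(H)=\inf\{|g|\}$ over fractional covers; both may be infinite. A partial sub-hypergraph of $H$ is $H'=(V',\mathcal{E}')$ with $V'\subseteq V$ and $\mathcal{E}'=\{E\cap V':E\in\mathcal{E}_0\}$ for some $\mathcal{E}_0\subseteq\mathcal{E}$. The tail hypergraph is $(\mathbb{N},\{E_j:j\in\mathbb{N}\})$ with $E_j=\{i\in\mathbb{N}:i\ge j\}$. Isomorphism of hypergraphs is a bijection of vertex sets inducing a bijection of edge sets. *)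

(* Defs.v *)
From HB Require Import structures.
From mathcomp Require Import all_boot all_order all_algebra.
From mathcomp Require Import all_classical all_reals.
From mathcomp Require Import ereal esum.
Set Implicit Arguments. Unset Strict Implicit. Unset Printing Implicit Defensive.
Import Order.TTheory GRing.Theory Num.Theory.
Local Open Scope classical_set_scope.
Local Open Scope ring_scope.

(* A hypergraph with vertices in an ambient (choice) type T is given by a
   vertex set V : set T and an edge set E : set (set T), every edge being a
   subset of V.  Infinite sums of nonnegative reals are the extended-real
   sums [esum] (supremum of finite partial sums). *)

Definition is_hypergraph (T : Type) (V : set T) (E : set (set T)) : Prop :=
  forall e, E e -> e `<=` V.

Definition partial_sub (T : Type) (V : set T) (E : set (set T))
    (V' : set T) (E' : set (set T)) : Prop :=
  V' `<=` V /\ exists E0 : set (set T), E0 `<=` E /\ E' = [set e `&` V' | e in E0].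

Section Frac.
Variables (R : realType) (T : choiceType).

Definition frac_matching (V : set T) (E : set (set T)) (f : set T -> R) : Prop :=
  (forall e, E e -> 0 <= f e) /\
  (forall v, V v -> (\esum_(e in [set e | E e /\ e v]) (f e)%:E <= 1%E)%E).

Definition frac_matching_size (E : set (set T)) (f : set T -> R) : \bar R :=
  (\esum_(e in E) (f e)%:E)%E.

Definition frac_cover (V : set T) (E : set (set T)) (g : T -> R) : Prop :=
  (forall v, V v -> 0 <= g v) /\
  (forall e, E e -> (1%E <= \esum_(v in e) (g v)%:E)%E).

Definition frac_cover_size (V : set T) (g : T -> R) : \bar R :=
  (\esum_(v in V) (g v)%:E)%E.

Definition nu_star (V : set T) (E : set (set T)) : \bar R :=
  ereal_sup [set frac_matching_size E f | f in frac_matching V E].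

Definition tau_star (V : set T) (E : set (set T)) : \bar R :=
  ereal_inf [set frac_cover_size V g | g in frac_cover V E].

End Frac.

Definition tail_edge (j : nat) : set nat := [set i | (j <= i)%N].

Definition iso_tail (T : Type) (V : set T) (E : set (set T)) : Prop :=
  exists phi : T -> nat,
    set_bij V setT phi /\
    (forall e, E e -> e `<=` V) /\
    (forall e, E e -> exists j, phi @` e = tail_edge j) /\
    (forall j, exists e, E e /\ phi @` e = tail_edge j).

(* Main.v *)
(* Weak duality is an exchange of sums, and in the tail hypergraph nu* <= 1 while
   tau* = oo.  Conversely, let nu* < c < c' < tau*.  Finitely many edges always have
   a finitely supported fractional cover of size c, so there are such covers s_0,
   s_1, ... where s_n covers edges realizing every trace of an edge on the supports
   of s_0, ..., s_(n-1).  Convex combinations of the s_n, rescaled to size c', are not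
   covers; by a minimax argument there are probability measures on edges giving each
   event "s_i, rescaled to a size between c and c', does not cover e" mass bounded
   below, and a measure-theoretic form of Ptak's lemma yields an ultrafilter on edges
   containing infinitely many of these events.  Let S be the set of vertices that
   belong to almost every edge, and let e_n be an edge covered by s_n, s_(n+1), ...
   having the same trace as S on the earlier supports.  Then infinitely many s_i give
   mass bounded below to e_n \ S for all n <= i, while every point of their supports
   outside S is in only finitely many e_n.  A second use of Ptak's lemma, now on
   vertices, extracts a half graph v_k \in e_(n_j) <-> j <= k, which is a tail.

   A finitely supported probability measure is represented by a list of points,
   with multiplicity. *)
Require Import Defs.
From HB Require Import structures.
From mathcomp Require Import all_boot all_order all_algebra.
From mathcomp Require Import finmap.
From mathcomp Require Import all_classical all_reals.
From mathcomp Require Import ereal esum normedtype numfun.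
From mathcomp Require Import ring lra.
Set Implicit Arguments. Unset Strict Implicit. Unset Printing Implicit Defensive.
Import Order.TTheory GRing.Theory Num.Theory.
Import numFieldNormedType.Exports.
Local Open Scope classical_set_scope.
Local Open Scope ring_scope.

(** * Averages over lists *)

Section Mean.
Variables (R : realFieldType) (X : eqType).
Implicit Types (s : seq X) (h : X -> R) (A D : set X).

(* The empty list has mean 0 by the convention x / 0 = 0. *)
Definition mean s h : R := (\sum_(x <- s) h x) / (size s)%:R.

Definition freq s A : R := mean s \1_A.

Lemma freq_ge0 s A : 0 <= freq s A.
Proof. by rewrite divr_ge0// sumr_ge0. Qed.

Lemma freq_le1 s A : freq s A <= 1.
Proof.
have [->|s0] := eqVneq s [::]; first by rewrite /freq /mean big_nil mul0r.
rewrite ler_pdivrMr ?ltr0n ?lt0n ?size_eq0// mul1r -sum1_size natr_sum.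
by apply: ler_sum => x _; rewrite indicE ler_nat leq_b1.
Qed.

Lemma le_mean s h h' : (forall x, x \in s -> h x <= h' x) -> mean s h <= mean s h'.
Proof.
move=> hh'; rewrite ler_wpM2r ?invr_ge0//.
by rewrite big_seq [leRHS]big_seq; exact: ler_sum.
Qed.

Lemma eq_mean s h h' : {in s, h =1 h'} -> mean s h = mean s h'.
Proof. by move=> hh'; congr (_ / _); exact: eq_big_seq. Qed.

Lemma meanN s h : mean s (fun x => - h x) = - mean s h.
Proof. by rewrite /mean sumrN mulNr. Qed.

Lemma mean_affine s c h b : s != [::] ->
  mean s (fun x => c * h x + b) = c * mean s h + b.
Proof.
move=> s0; rewrite /mean big_split/= -mulr_sumr big_const_seq count_predT.
rewrite iter_addr_0 -[b *+ _]mulr_natr mulrDl -mulrA mulfK//.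
by rewrite pnatr_eq0 size_eq0.
Qed.

Lemma freqI_supp s A D : [set` s] `<=` D -> freq s (A `&` D) = freq s A.
Proof.
move=> sD; apply: eq_mean => x /sD/mem_set xD.
by rewrite !indicE in_setI xD andbT.
Qed.

Lemma markov_freq s h b : s != [::] -> 0 < b -> (forall x, 0 <= h x) ->
  1 - mean s h / b <= freq s [set x | h x < b].
Proof.
move=> s0 b0 h0; have -> : 1 - mean s h / b = mean s (fun x => - b^-1 * h x + 1).
  by rewrite mean_affine// mulNr mulrC addrC.
apply: le_mean => x _; rewrite indicE mulNr mulrC addrC.
have [_|] := boolP (x \in _); first by rewrite gerBl divr_ge0// ltW.
by rewrite notin_setE/= => /negP; rewrite -leNgt subr_le0 ler_pdivlMr ?mul1r.
Qed.

End Mean.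
Arguments freq R {X} s A.

(** * Approximate minimax *)

Definition convex_weights (R : realFieldType) (J : finType) (w : J -> R) :=
  (forall j, 0 <= w j) /\ \sum_j w j = 1.

Section Minimax.
Variables (R : archiRealFieldType) (X : eqType) (J : finType).
Implicit Types (D : set X) (a : X -> J -> R) (w y : J -> R).

Lemma convex_weights_delta (j0 : J) : convex_weights (fun j => (j == j0)%:R : R).
Proof.
split=> [j|]; first by rewrite ler0n.
by rewrite (bigD1 j0)//= eqxx big1 ?addr0// => j /negPf ->.
Qed.

Lemma value_nonneg_weights (j0 : J) D a v :
  (forall w, convex_weights w -> exists2 x, D x & v <= \sum_j w j * a x j) ->
  forall w, (forall j, 0 <= w j) ->
  exists2 x, D x & v * \sum_j w j <= \sum_j w j * a x j.
Proof.
move=> value w w0; have [sw0|sw0] := eqVneq (\sum_j w j) 0.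
  have wE j : w j = 0 by have/psumr_eq0P := sw0; apply.
  have [x Dx _] := value _ (convex_weights_delta j0); exists x => //.
  by rewrite sw0 mulr0 big1// => j _; rewrite wE mul0r.
have sw_gt0 : 0 < \sum_j w j by rewrite lt_neqAle eq_sym sw0 sumr_ge0.
have [|x Dx vx] := value (fun j => w j / \sum_j w j).
  split=> [j|]; first by rewrite divr_ge0// ltW.
  by rewrite /= -mulr_suml divff.
exists x => //; rewrite -ler_pdivlMr// mulr_suml.
by apply: le_trans vx _; apply: ler_sum => j _; rewrite mulrAC.
Qed.

Lemma sqr_funrnegD_le y (b : J -> R) j :
  (y \+ b)^\- j ^+ 2 <= (y^\- j - b j) ^+ 2.
Proof.
rewrite /funrneg/=; case: (lerP (- (y j + b j)) 0) => [_|yb].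
  by rewrite expr0n sqr_ge0.
by case: (lerP (- y j) 0) => yj; nra.
Qed.

(* Blackwell approachability: each point is chosen to pair nonnegatively with the
   negative part of the current sum, so the cross term in its square drops out. *)
Lemma approachability D a M : (forall x j, D x -> `|a x j| <= M) ->
  (forall w, (forall j, 0 <= w j) -> exists2 x, D x & 0 <= \sum_j w j * a x j) ->
  forall n, exists s, [/\ size s = n, [set` s] `<=` D &
    \sum_j (fun j => \sum_(x <- s) a x j)^\- j ^+ 2 <= n%:R * (#|J|%:R * M ^+ 2)].
Proof.
move=> aM value; elim=> [|n [s [sn sD sle]]].
  exists [::]; split => //; rewrite mul0r big1// => j _.
  by rewrite /funrneg big_nil oppr0 maxxx expr0n.
pose y j := \sum_(x <- s) a x j.
have [|x Dx ax] := value y^\-; first by move=> j; exact: funrneg_ge0.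
exists (x :: s); split => /=; first by rewrite sn.
  by move=> z; rewrite /= inE => /orP[/eqP ->|/sD].
have term_le j : (fun j => \sum_(z <- x :: s) a z j)^\- j ^+ 2 <=
    y^\- j ^+ 2 - 2 * (y^\- j * a x j) + M ^+ 2.
  have -> : (fun j => \sum_(z <- x :: s) a z j) = y \+ a x.
    by apply/funext => i; rewrite big_cons addrC.
  apply: le_trans (sqr_funrnegD_le _ _ _) _.
  rewrite sqrrB mulr2n mulrDl mul1r lerD2l -[leLHS]real_normK ?num_real//.
  by rewrite lerXn2r ?nnegrE ?aM// (le_trans _ (aM x j Dx)).
apply: le_trans (ler_sum _ (fun j _ => term_le j)) _.
rewrite !big_split/= sumrN -mulr_sumr sumr_const -[M ^+ 2 *+ _]mulr_natl -(natr1 n).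
rewrite [leRHS]mulrDl mul1r lerD2r; apply: le_trans sle.
by rewrite gerBl mulr_ge0.
Qed.

Lemma approx_minimax (j0 : J) D a M v eps : (forall x j, D x -> `|a x j| <= M) ->
  (forall w, convex_weights w -> exists2 x, D x & v <= \sum_j w j * a x j) ->
  0 < eps -> exists s, [/\ s != [::], [set` s] `<=` D &
    forall j, v - eps <= mean s (a^~ j)].
Proof.
move=> aM value eps0; pose b x j := a x j - v; pose C := #|J|%:R * (M + `|v|) ^+ 2.
have bM x j : D x -> `|b x j| <= M + `|v|.
  by move=> Dx; rewrite (le_trans (ler_normB _ _))// lerD2r aM.
have b_value w : (forall j, 0 <= w j) -> exists2 x, D x & 0 <= \sum_j w j * b x j.
  move=> w0; have [x Dx vx] := value_nonneg_weights j0 value w0; exists x => //.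
  under eq_bigr do rewrite mulrBr.
  by rewrite sumrB -mulr_suml subr_ge0 mulrC.
have [n n0 Cn] : exists2 n, (0 < n)%N & C <= eps ^+ 2 * n%:R.
  exists (Num.truncn (C / eps ^+ 2)).+1 => //.
  by rewrite mulrC -ler_pdivrMr ?exprn_gt0// ltW// truncnS_gt.
have [s [sn sD sle]] := approachability bM b_value n.
have s0 : s != [::] by rewrite -size_eq0 sn -lt0n.
exists s; split => // j; pose y j := \sum_(x <- s) b x j.
have y_le : y^\- j <= eps * n%:R.
  rewrite -(@ler_pXn2r _ 2) ?nnegrE ?funrneg_ge0 ?mulr_ge0 ?(ltW eps0)//.
  apply: (@le_trans _ _ (n%:R * C)); last first.
    by rewrite exprMn [n%:R ^+ 2]expr2 mulrA [leRHS]mulrC ler_wpM2l.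
  apply: le_trans sle; rewrite (bigD1 j)//= lerDl.
  by apply: sumr_ge0 => i _; exact: sqr_ge0.
have -> : mean s (a^~ j) = y j / (size s)%:R + v.
  rewrite -[X in X + v]mul1r -(mean_affine 1)//.
  by apply: eq_mean => x _; rewrite mul1r subrK.
rewrite addrC lerD2r sn ler_pdivlMr ?ltr0n// mulNr lerNl.
by apply: le_trans y_le; rewrite /funrneg le_max lexx.
Qed.

End Minimax.

(** * Charges and ultrafilters *)

Section Ultrafilters.
Variables (X : Type) (U : set_system X).
Hypothesis UU : UltraFilter U.

Lemma ultra_bigcup_ord (A : nat -> set X) n :
  U (\bigcup_(i < n) A i) -> exists2 i, (i < n)%N & U (A i).
Proof.
elim: n => [|n IHn]; first by rewrite bigcup_mkord big_ord0 => /filter_ex[].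
rewrite bigcup_mkord big_ord_recr/= -bigcup_mkord => UA.
have [UAn|UAn] := in_ultra_setVsetC (A n) UU; first by exists n.
have [|i i_n UAi] := IHn; last by exists i => //; rewrite ltnS ltnW.
by apply: filterS (filterI UA UAn) => x [[]].
Qed.

Lemma fmap_ultra (Y : Type) (f : X -> Y) : UltraFilter (f @ U).
Proof.
split=> [|G GG UG]; first exact: fmap_proper_filter.
apply/seteqP; split=> // S GS.
have [//|UnS] := in_ultra_setVsetC (f @^-1` S) UU.
have : G (S `&` ~` S) by apply: filterI => //; exact: UG.
by rewrite setICr => /filter_ex[].
Qed.

Lemma ultra_cvg_compact (Y : topologicalType) (K : set Y) (f : X -> Y) :
  compact K -> (forall x, K (f x)) -> exists l : Y, f x @[x --> U] --> l.
Proof.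
rewrite compact_ultra => /(_ _ (fmap_ultra f)) cK Kf.
have [|l [_ fl]] := cK; first exact: (@filterE _ U).
by exists l.
Qed.

End Ultrafilters.

Lemma bigcap_ultrafilter (X : Type) (K : nat -> set X) :
  (forall n, \bigcap_(k < n) K k !=set0) ->
  exists2 U : set_system X, UltraFilter U & forall n, U (K n).
Proof.
move=> K0; pose F := filter_from setT (fun n => \bigcap_(k < n) K k).
have FF : ProperFilter F.
  apply: filter_from_proper => [|n _]; last exact: K0.
  apply: filter_fromT_filter; first by exists 0%N.
  move=> i j; exists (maxn i j) => x Kx.
  by split=> k kij; apply: Kx; rewrite /= leq_max kij ?orbT.
have [U [UU FU]] := ultraFilterLemma FF.
by exists U => // n; apply: FU; exists n.+1 => // x; apply; exact: ltnSn.
Qed.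

Definition infinitely_often (P : nat -> Prop) :=
  exists2 j : nat -> nat, (forall n, (n <= j n)%N) & forall n, P (j n).

Section Charge.
Variables (R : realType) (X : Type).

Record subprobability_charge (m : set X -> R) : Prop := {
  charge_ge0 : forall A, 0 <= m A;
  charge_le1 : forall A, m A <= 1;
  chargeU : forall A B, A `&` B = set0 -> m (A `|` B) = m A + m B }.

Variables (m : set X -> R).
Hypothesis charge_m : subprobability_charge m.
Implicit Types (A B : set X).

Lemma charge0 : m set0 = 0.
Proof. by have := chargeU charge_m (setI0 set0); rewrite setU0; lra. Qed.

Lemma chargeID A B : m A = m (A `&` B) + m (A `\` B).
Proof.
rewrite -chargeU//; first by rewrite setUIDK.
by rewrite setDE setIACA setICr setI0.
Qed.

Lemma le_charge A B : A `<=` B -> m A <= m B.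
Proof.
by move=> AB; rewrite (chargeID B A) (setIidr AB) lerDl; exact: charge_ge0.
Qed.

Lemma chargeD_ge A B : m A - m B <= m (A `\` B).
Proof. by rewrite lerBlDr (chargeID A B) addrC lerD2l le_charge. Qed.

Lemma chargeD A B : B `<=` A -> m (A `\` B) = m A - m B.
Proof. by move=> BA; rewrite (chargeID A B) (setIidr BA) addrAC subrr add0r. Qed.

Lemma charge_bigcup_le (A : nat -> set X) n :
  m (\bigcup_(k < n) A k) <= \sum_(k < n) m (A k).
Proof.
rewrite bigcup_mkord; elim: n => [|n IHn]; first by rewrite !big_ord0 charge0.
rewrite !big_ord_recr/= (chargeID _ (A n)) addrC; apply: lerD.
  by apply: le_charge; exact: subIsetr.
by apply: le_trans IHn; apply: le_charge => x [[]].
Qed.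

Lemma charge_bigcup_saturates (A : nat -> set X) (eps : R) : 0 < eps ->
  exists n, forall k, m (A k `\` \bigcup_(i < n) A i) <= eps.
Proof.
move=> eps0; pose W n := \bigcup_(i < n) A i.
have W_has_sup : has_sup (range (m \o W)).
  split; first by exists (m (W 0%N)), 0%N.
  by exists 1 => _ [n _ <-]; exact: charge_le1.
have [_ [n _ <-] Wn] := sup_adherent eps0 W_has_sup.
exists n => k; pose N := maxn n k.+1.
have WnN : W n `<=` W N by move=> x [i i_n Aix]; exists i; rewrite //= leq_max i_n.
apply: (@le_trans _ _ (m (W N `\` W n))).
  apply: le_charge; apply: setSD => x Akx.
  by exists k; rewrite //= leq_max ltnSn orbT.
have := sup_upper_bound W_has_sup (imageT (m \o W) N).
by rewrite chargeD//=; move: Wn => /=; lra.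
Qed.

Lemma charge_ultrafilter (B : nat -> set X) (delta : R) :
  0 < delta -> (forall i, delta <= m (B i)) ->
  exists2 U : set_system X, UltraFilter U & infinitely_often (fun j => U (B j)).
Proof.
move=> delta0 Bdelta.
(* K n is a finite union of sets B k with k >= n, so large that the charges of
   B n outside K 0, ..., K (n - 1) add up to less than delta.  Hence the K n
   generate a proper filter, and an ultrafilter containing K n contains some B k
   with k >= n. *)
have /choice[N NP] n : exists N, forall k,
    m (B (n + k)%N `\` \bigcup_(i < N) B (n + i)%N) <= delta / 2 ^+ n.+1.
  apply: (charge_bigcup_saturates (fun k => B (n + k)%N)).
  by rewrite divr_gt0 ?exprn_gt0.
pose K n := \bigcup_(i < N n) B (n + i)%N.
have sum_lt n : \sum_(k < n) delta / 2 ^+ k.+1 < delta.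
  suff -> : \sum_(k < n) delta / 2 ^+ k.+1 = delta - delta / 2 ^+ n.
    by rewrite gtrBl divr_gt0 ?exprn_gt0.
  elim: n => [|n IHn]; first by rewrite big_ord0 expr0 divr1 subrr.
  by rewrite big_ord_recr/= IHn exprS; field; rewrite expf_neq0.
have K0 n : \bigcap_(k < n) K k !=set0.
  apply/set0P/negP => /eqP K_empty.
  have : m (B n) <= \sum_(k < n) delta / 2 ^+ k.+1.
    rewrite -(setD0 (B n)) -K_empty setDE setC_bigcap setI_bigcupr.
    apply: le_trans (charge_bigcup_le _ _) _; apply: ler_sum => k _.
    by rewrite -setDE -[n in B n](subnKC (ltnW (ltn_ord k))); exact: NP.
  by rewrite leNgt (lt_le_trans (sum_lt n)).
have [U UU UK] := bigcap_ultrafilter K0; exists U => //.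
have /choice[j jP] n : exists j, (n <= j)%N /\ U (B j).
  have [i _ UB] := ultra_bigcup_ord UU (UK n).
  by exists (n + i)%N; split => //; exact: leq_addr.
by exists j => n; have [] := jP n.
Qed.

End Charge.

Lemma charge_ultralimit (R : realType) (X : Type) (p : nat -> set X -> R)
    (B : nat -> set X) (delta : R) :
  (forall n, subprobability_charge (p n)) ->
  (forall i n, (i <= n)%N -> delta <= p n (B i)) ->
  exists2 m : set X -> R, subprobability_charge m & forall i, delta <= m (B i).
Proof.
move=> charge_p pB; have [U [UU oU]] := ultraFilterLemma eventually_filter.
have /choice[m p_m] A : exists l : R, p n A @[n --> U] --> l.
  apply: (ultra_cvg_compact UU (@segment_compact R 0 1)) => n.
  by rewrite /= in_itv/= (charge_ge0 (charge_p n)) (charge_le1 (charge_p n)).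
exists m; first split.
- move=> A; apply: cvgr_to_ge (p_m A) _; apply: filterE => n; exact: charge_ge0.
- move=> A; apply: cvgr_to_le (p_m A) _; apply: filterE => n; exact: charge_le1.
- move=> A C AC.
  have p_mAC : p n A + p n C @[n --> U] --> m (A `|` C).
    suff -> : (fun n => p n A + p n C) = (fun n => p n (A `|` C)) by exact: p_m.
    by apply/funext => n; rewrite (chargeU (charge_p n)).
  exact: norm_cvg_unique p_mAC (cvgD (p_m A) (p_m C)).
- move=> i; apply: cvgr_to_ge (p_m _) _; apply: oU.
  by exists i => // n /= ni; exact: pB.
Qed.

(* A measure-theoretic form of Ptak's lemma. *)
Lemma charges_ultrafilter (R : realType) (X : Type) (p : nat -> set X -> R)
    (B : nat -> set X) (delta : R) :
  (forall n, subprobability_charge (p n)) -> 0 < delta ->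
  (forall i n, (i <= n)%N -> delta <= p n (B i)) ->
  exists2 U : set_system X, UltraFilter U & infinitely_often (fun j => U (B j)).
Proof.
move=> charge_p delta0 pB; have [m charge_m mB] := charge_ultralimit charge_p pB.
exact: (charge_ultrafilter charge_m delta0 mB).
Qed.

Lemma freq_charge (R : realType) (X : eqType) (s : seq X) :
  subprobability_charge (freq R s).
Proof.
split=> [A|A|A B AB]; [exact: freq_ge0|exact: freq_le1|].
rewrite /freq /mean -mulrDl -big_split/=; congr (_ / _); apply: eq_bigr => x _.
rewrite !indicE in_setU -natrD; congr _%:R.
have := @in_set0 _ x; rewrite -AB in_setI.
by case: (x \in A) (x \in B) => [] [].
Qed.

(** * Traces on finite sets *)

Lemma finType_representatives (X : eqType) (F : finType) (f : X -> F) (E : set X) :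
  exists2 L : seq X, [set` L] `<=` E &
    forall x, E x -> exists2 y, y \in L & f x = f y.
Proof.
have /choice[g gP] (c : F) : exists o : option X,
    if o is Some x then E x /\ f x = c else forall x, E x -> f x <> c.
  have [[x [Ex xc]]|noE] := pselect (exists x, E x /\ f x = c).
    by exists (Some x).
  by exists None => x Ex xc; apply: noE; exists x.
exists (pmap g (enum F)) => [x|x Ex].
  by rewrite /= mem_pmap => /mapP[c _ gc]; have := gP c; rewrite -gc => -[].
case gfx : (g (f x)) (gP (f x)) => [y|]; last by move=> /(_ x Ex).
by case=> _ fyx; exists y => //; rewrite mem_pmap -gfx map_f ?mem_enum.
Qed.

Definition agree_on (T : eqType) (s : seq T) (A B : set T) :=
  A `&` [set` s] = B `&` [set` s].

Lemma trace_representatives (T : eqType) (E : set (set T)) (s : seq T) :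
  exists2 L : seq (set T), [set` L] `<=` E &
    forall e, E e -> exists2 e', e' \in L & agree_on s e e'.
Proof.
have [L LE Lrep] := finType_representatives
  (fun e : set T => [ffun i : 'I_(size s) => tnth (in_tuple s) i \in e]) E.
exists L => // e /Lrep[e' e'L /ffunP ee']; exists e' => //.
have {}ee' v : v \in s -> (v \in e) = (v \in e').
  by move=> /(tnthP (in_tuple s))[i ->]; have := ee' i; rewrite !ffunE.
apply/seteqP; split=> v [/mem_set ev vs]; split=> //; apply: set_mem.
  by rewrite -ee'.
by rewrite ee'.
Qed.

Definition ultralimit_set (T : Type) (U : set_system (set T)) : set T :=
  [set v | U [set e | e v]].

Lemma ultra_agree_on (T : choiceType) (U : set_system (set T)) (s : seq T) :
  UltraFilter U -> U [set e | agree_on s e (ultralimit_set U)].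
Proof.
move=> UU; have Uv v : U [set e : set T | e v <-> ultralimit_set U v].
  have [Uv|Uv] := in_ultra_setVsetC [set e : set T | e v] UU.
    by apply: filterS (Uv) => e /= ev.
  apply: filterS (Uv) => e /= nev; split => // Sv.
  by have [e' []] := filter_ex (filterI Uv Sv).
apply: filterS (@filter_bigI _ _ [fset v in s]%fset _ U _ (fun v _ => Uv v)).
move=> e /= eS; have {}eS v : v \in s -> e v <-> ultralimit_set U v.
  by move=> vs; apply: eS; rewrite /= inE.
by apply/seteqP; split=> v [ev vs]; split=> //; exact/(eS v).
Qed.

Lemma course_of_values (A : Type) (F : seq A -> A) :
  exists a : nat -> A, forall n, a n = F (mkseq a n).
Proof.
pose history := fix history n :=
  if n is n'.+1 then rcons (history n') (F (history n')) else [::].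
exists (F \o history) => n; rewrite /=; congr F.
by elim: n => //= n IHn; rewrite mkseqS /= -IHn.
Qed.

(* s i is made to satisfy P on representatives of all traces on s 0, ..., s (n - 1),
   for every n <= i. *)
Lemma trace_adapted_sequence (T : eqType) (E : set (set T))
    (G : set (seq T)) (P : seq T -> set T -> Prop) :
  (forall L : seq (set T), [set` L] `<=` E ->
     exists2 s, G s & forall e, e \in L -> P s e) ->
  exists2 s : nat -> seq T, (forall n, G (s n)) &
    forall n e, E e -> exists e', [/\ E e',
      agree_on (flatten (mkseq s n)) e e' &
      forall i, (n <= i)%N -> P (s i) e'].
Proof.
move=> handled.
have /choice[F FP] (L : seq (set T)) : exists s, [set` L] `<=` E ->
    G s /\ forall e, e \in L -> P s e.
  have [/handled[s Gs Ps]|nLE] := pselect ([set` L] `<=` E); first by exists s.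
  by exists [::] => /nLE.
have /choice[rep repP] (s : seq T) : exists L : seq (set T), [set` L] `<=` E /\
    forall e, E e -> exists2 e', e' \in L & agree_on s e e'.
  by have [L LE Lrep] := trace_representatives E s; exists L.
pose todo (h : seq (seq T)) :=
  flatten [seq rep (flatten (take n h)) | n <- iota 0 (size h).+1].
have [s sE] := course_of_values (F \o todo).
have todoE i : [set` todo (mkseq s i)] `<=` E.
  by move=> e /flattenP[_ /mapP[n _ ->]]; exact: (repP _).1.
have sP i := FP _ (todoE i).
exists s => [n|n e Ee]; first by rewrite sE; exact: (sP n).1.
have [e' e'rep ee'] := (repP (flatten (mkseq s n))).2 e Ee.
exists e'; split=> // [|i ni]; first exact: (repP _).1 e'rep.
rewrite sE; apply: (sP i).2; apply/flattenP.
exists (rep (flatten (mkseq s n))) => //; apply/mapP; exists n.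
  by rewrite mem_iota size_mkseq.
by rewrite -map_take take_iota (minn_idPl ni).
Qed.

(** * Half graphs *)

Definition half_graph (T : Type) (v : nat -> T) (e : nat -> set T) :=
  forall j k, e j (v k) <-> (j <= k)%N.

Lemma half_graph_subseq (T : Type) (v : nat -> T) (e : nat -> set T) :
  (forall j k, (j <= k)%N -> e j (v k)) ->
  (forall k, \forall j \near \oo, ~ e j (v k)) ->
  exists i : nat -> nat, half_graph (v \o i) (e \o i).
Proof.
move=> ev v_out.
have /choice[N NP] k : exists N, forall j, (N <= j)%N -> ~ e j (v k).
  by have [N _ NP] := v_out k; exists N.
pose i n := iter n (fun k => maxn k.+1 (N k)) 0%N.
have i_mono : {homo i : m n / (m <= n)%N}.
  by apply: homo_leq => // [|n]; [exact: leq_trans|rewrite /= leq_max leqnSn].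
exists i => j k; split=> [|jk]; last exact/ev/i_mono.
apply: contraPT; rewrite -ltnNge => kj; apply: NP.
by apply: leq_trans (i_mono _ _ kj); rewrite leq_maxr.
Qed.

Lemma charges_half_graph (R : realType) (T : Type) (V : set T) (e : nat -> set T)
    (p : nat -> set T -> R) (delta : R) :
  (forall i, subprobability_charge (p i)) -> 0 < delta ->
  (forall n i, (n <= i)%N ->
     delta <= p i [set v | [/\ V v, e n v & \forall k \near \oo, ~ e k v]]) ->
  exists (v : nat -> T) (i : nat -> nat),
    (forall k, V (v k)) /\ half_graph v (e \o i).
Proof.
move=> charge_p delta0 p_delta.
have [U UU [j j_ge Uj]] := charges_ultrafilter charge_p delta0 p_delta.
pose B n := [set v | [/\ V v, e n v & \forall k \near \oo, ~ e k v]].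
have /choice[v vB] k : exists v, forall n : 'I_k.+1, B (j n) v.
  by apply: (@filter_ex _ U); apply: filter_forall => n; exact: Uj.
have v_in n k : (n <= k)%N -> B (j n) (v k).
  by rewrite -ltnS => nk; exact: (vB k (Ordinal nk)).
have v_out k : \forall n \near \oo, ~ e (j n) (v k).
  have [_ _ [N _ NP]] := v_in 0%N k (leq0n k).
  by exists N => // n /= Nn; apply: NP; exact: leq_trans (j_ge n).
have [|i ev] := @half_graph_subseq T v (e \o j) _ v_out.
  by move=> n k /v_in[].
exists (v \o i), (j \o i); split=> // k.
by have [] := v_in 0%N (i k) (leq0n _).
Qed.

Lemma escaping_mass_half_graph (R : realType) (T : choiceType) (V S : set T)
    (s : nat -> seq T) (e : nat -> set T) (j : nat -> nat) (a b : R) :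
  b < a -> (forall i, [set` s i] `<=` V) ->
  (forall n, agree_on (flatten (mkseq s n)) (e n) S) ->
  (forall n i, (n <= i)%N -> a <= freq R (s i) (e n)) ->
  (forall n, (n <= j n)%N) -> (forall n, freq R (s (j n)) S <= b) ->
  exists (v : nat -> T) (i : nat -> nat),
    (forall k, V (v k)) /\ half_graph v (e \o i).
Proof.
move=> ba sV eS e_ge j_ge S_le.
have avoided i v : v \in s i -> ~ S v -> \forall k \near \oo, ~ e k v.
  move=> vs nSv; exists i.+1 => // k /= ik ekv.
  have : (e k `&` [set` flatten (mkseq s k)]) v.
    split=> //; apply/flattenP; exists (s i) => //.
    by apply/mapP; exists i; rewrite ?mem_iota.
  by rewrite eS => -[].
apply: (charges_half_graph (fun n => freq_charge R (s (j n))) (_ : 0 < a - b)).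
  by rewrite subr_gt0.
move=> n i ni; have charge_s := freq_charge R (s (j i)).
have e_diff : a - b <= freq R (s (j i)) (e n `\` S).
  apply: le_trans (chargeD_ge charge_s _ _).
  by rewrite lerB// e_ge// (leq_trans ni).
apply: le_trans e_diff _; rewrite -(freqI_supp _ (e n `\` S) (fun=> id)).
apply: (le_charge charge_s) => v [[ev nSv] vs].
by split=> //; [exact: sV vs|exact: avoided vs nSv].
Qed.

Lemma partial_sub_trans (T : Type) (V V' V'' : set T) (E E' E'' : set (set T)) :
  partial_sub V E V' E' -> partial_sub V' E' V'' E'' -> partial_sub V E V'' E''.
Proof.
move=> [V'V [E0 [E0E ->]]] [V''V' [E1 [E1E ->]]].
split; first exact: subset_trans V'V.
have traceV'' e : e `&` V' `&` V'' = e `&` V'' by rewrite -setIA (setIidr V''V').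
exists [set e | E0 e /\ E1 (e `&` V')]; split; first by move=> e [/E0E].
apply/seteqP; split => [_ [e E1e <-]|_ [e [E0e E1e] <-]].
  have [e' E0e' e'e] := E1E _ E1e; exists e'; first by rewrite /= e'e.
  by rewrite -e'e traceV''.
by exists (e `&` V').
Qed.

Lemma partial_sub_hypergraph (T : Type) (V V' : set T) (E E' : set (set T)) :
  partial_sub V E V' E' -> is_hypergraph V' E'.
Proof. by move=> [_ [E0 [_ ->]]] _ [e _ <-]; exact: subIsetr. Qed.

Definition has_tail (T : Type) (V : set T) (E : set (set T)) :=
  exists V' E', partial_sub V E V' E' /\ iso_tail V' E'.

Lemma half_graph_has_tail (T : Type) (V : set T) (E : set (set T))
    (v : nat -> T) (e : nat -> set T) :
  (forall k, V (v k)) -> (forall j, E (e j)) -> half_graph v e -> has_tail V E.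
Proof.
move=> Vv Ee ev.
have v_inj : injective v.
  move=> k l kl; apply/eqP; rewrite eqn_leq; apply/andP; split; apply/ev.
    by rewrite -kl; apply/ev.
  by rewrite kl; apply/ev.
have /choice[rank rankP] x : exists k, range v x -> v k = x.
  by have [[k _ <-]|] := pselect (range v x); [exists k|exists 0%N].
have rank_v k : rank (v k) = k by apply: v_inj; apply: rankP; exists k.
have rank_e j : rank @` (e j `&` range v) = tail_edge j.
  apply/seteqP; split => [_ [x [ex [k _ vx]] <-]|k jk].
    by rewrite -vx rank_v; apply/ev; rewrite vx.
  by exists (v k); [split; [exact/ev|exists k]|exact: rank_v].
exists (range v), [set e' `&` range v | e' in range e]; split.
  split; first by move=> _ [k _ <-].
  by exists (range e); split => // _ [j _ <-].
exists rank; split; last split; last split.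
- split=> //; last by move=> k _; exists (v k); [exists k|exact: rank_v].
  by move=> _ _ /set_mem[k _ <-] /set_mem[l _ <-]; rewrite !rank_v => ->.
- by move=> _ [e' _ <-]; exact: subIsetr.
- by move=> _ [_ [j _ <-] <-]; exists j.
- by move=> j; exists (e j `&` range v); split => //; exists (e j) => //; exists j.
Qed.

(** * Fractional matchings and covers *)

Section ExtendedSums.
Variable R : realType.
Local Open Scope ereal_scope.

Lemma ge0_esumZl (Y : choiceType) (A : set Y) (c : R) (a : Y -> \bar R) :
  (0 <= c)%R -> (forall y, A y -> 0 <= a y) ->
  \esum_(y in A) (c%:E * a y) = c%:E * \esum_(y in A) a y.
Proof.
have le_esumZl (d : R) (b : Y -> \bar R) :
    (0 <= d)%R -> (forall y, A y -> 0 <= b y) ->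
    \esum_(y in A) (d%:E * b y) <= d%:E * \esum_(y in A) b y.
  move=> d0 b0; apply: ge_ereal_sup => _ [X [finX XA] <-].
  rewrite fsbig_finite//= big_seq -ge0_sume_distrr => [|y]; last first.
    by rewrite in_fset_set// => /set_mem/XA/b0.
  rewrite lee_wpmul2l ?lee_fin// -big_seq -fsbig_finite//.
  by apply: ereal_sup_ubound; exists X.
move=> c0 a0; apply/eqP; rewrite eq_le le_esumZl//=.
have [->|c_neq0] := eqVneq c 0%R.
  by rewrite mul0e esum_ge0// => y _; rewrite mul0e.
have c_gt0 : (0 < c)%R by rewrite lt_neqAle eq_sym c_neq0.
rewrite -lee_pdivlMl//.
apply: le_trans (le_esumZl _ _ _ _); last 2 first.
- by rewrite invr_ge0.
- by move=> y /a0 ay0; rewrite mule_ge0.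
by apply: le_esum => y _; rewrite muleA -EFinM mulVf// mul1e.
Qed.

Lemma exchange_esum_dep (I J : choiceType) (A : set I) (B : set J)
    (Q : I -> set J) (a : I -> J -> \bar R) :
  (forall i j, A i -> B j -> Q i j -> 0 <= a i j) ->
  \esum_(i in A) \esum_(j in B `&` Q i) a i j =
  \esum_(j in B) \esum_(i in A `&` Q^~ j) a i j.
Proof.
move=> a0.
rewrite (esum_esum (J := fun i => B `&` Q i)); last first.
  by move=> i j Ai [Bj Qij]; exact: a0.
rewrite (esum_esum (J := fun j => A `&` Q^~ j)); last first.
  by move=> j i Bj [Ai Qij]; exact: a0.
rewrite (reindex_esum (B `*`` (fun j => A `&` Q^~ j)) _ (fun x => (x.2, x.1)))//.
split=> [[j i] [Bj [Ai Qij]]//|[j i] [j' i'] _ _ [-> ->]//|[i j] [Ai [Bj Qij]]].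
by exists (j, i).
Qed.

Lemma esum_freq (X : choiceType) (s : seq X) (A : set X) :
  \esum_(x in A) (freq R s [set x])%:E = (freq R s A)%:E.
Proof.
rewrite /freq /mean.
under eq_esum => x _ do rewrite mulr_suml -sumEFin.
rewrite esum_sum => [|x y _ _]; last by rewrite lee_fin divr_ge0.
rewrite mulr_suml -sumEFin; apply: eq_bigr => y _.
transitivity (\esum_(x in A `&` [set y]) ((size s)%:R^-1%:E : \bar R)).
  rewrite esum_mkcondr; apply: eq_esum => x _; rewrite indicE.
  rewrite (_ : (y \in [set x]) = (x \in [set y])).
    by case: ifP; rewrite ?mul1r ?mul0r.
  by apply/idP/idP => /set_mem ->; exact: mem_set.
have [Ay|nAy] := boolP (y \in A).
  rewrite setIidr; last by move=> _ ->; exact: set_mem.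
  by rewrite esum_set1 ?lee_fin ?invr_ge0// indicE Ay mul1r.
rewrite indicE (negPf nAy) mul0r esum1// => x [Ax xy].
by rewrite -xy mem_set in nAy.
Qed.

Lemma esum_mixture_freq (X : choiceType) (J : finType) (w : J -> R)
    (s : J -> seq X) (c : R) (A : set X) : (forall j, 0 <= w j)%R -> (0 <= c)%R ->
  \esum_(x in A) (c * \sum_j w j * freq R (s j) [set x])%R%:E =
  (c * \sum_j w j * freq R (s j) A)%R%:E.
Proof.
move=> w0 c0; have wf0 j B : (0 <= (w j)%:E * (freq R (s j) B)%:E).
  by rewrite mule_ge0 ?lee_fin ?w0 ?freq_ge0.
under eq_esum => x _ do rewrite EFinM -sumEFin.
rewrite ge0_esumZl// => [|x _]; last by apply: sume_ge0 => j _; exact: wf0.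
rewrite esum_sum => [|x j _ _]; last exact: wf0.
rewrite EFinM -sumEFin; congr (_ * _); apply: eq_bigr => j _.
under eq_esum do rewrite EFinM.
by rewrite ge0_esumZl ?esum_freq// => x _; rewrite lee_fin freq_ge0.
Qed.

Lemma lte_fin_between (x y : \bar R) : x < y -> exists2 r : R, x < r%:E & r%:E < y.
Proof.
case: x y => [x| |] [y| |]//.
- by rewrite lte_fin => xy; exists ((x + y) / 2)%R; rewrite lte_fin ?midf_lt.
- by move=> _; exists (x + 1)%R; rewrite ?lte_fin ?ltrDl ?ltry//.
- by move=> _; exists (y - 1)%R; rewrite ?lte_fin ?gtrBl ?ltNyr//.
- by move=> _; exists 0%R; rewrite ?ltry ?ltNyr.
Qed.

End ExtendedSums.

Lemma finite_set_nat_ub (X : choiceType) (A : set X) (f : X -> nat) :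
  finite_set A -> exists N, forall x, A x -> (f x < N)%N.
Proof.
move=> finA; exists (\max_(x <- enum_fset (fset_set A)) f x).+1 => x Ax.
by rewrite ltnS leq_bigmax_seq// in_fset_set// mem_set.
Qed.

Section Duality.
Variables (R : realType) (T : choiceType).
Implicit Types (V : set T) (E : set (set T)).

Lemma nu_star_ge0 V E : (0 <= nu_star R V E)%E.
Proof.
apply: ereal_sup_ubound; exists (fun=> 0).
  by split => // v _; rewrite esum1// lee01.
by rewrite /frac_matching_size esum1.
Qed.

Lemma nu_star_le_tau_star V E :
  is_hypergraph V E -> (nu_star R V E <= tau_star R V E)%E.
Proof.
move=> EV; apply: ge_ereal_sup => _ [f [f0 f1] <-].
apply: le_ereal_inf_tmp => _ [g [g0 g1] <-].
apply: (@le_trans _ _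
    (\esum_(e in E) \esum_(v in V `&` e) ((f e)%:E * (g v)%:E))%E).
  apply: le_esum => e Ee; rewrite (setIidr (EV e Ee)).
  rewrite ge0_esumZl ?f0// => [|v /(EV e Ee) Vv]; last by rewrite lee_fin g0.
  by rewrite -[leLHS]mule1 lee_wpmul2l ?lee_fin ?f0 ?g1.
rewrite (exchange_esum_dep (Q := id)) => [|e v Ee Vv _]; last first.
  by rewrite mule_ge0 ?lee_fin ?f0 ?g0.
apply: le_esum => v Vv; under eq_esum do rewrite muleC.
rewrite ge0_esumZl ?g0// => [|e [Ee _]]; last by rewrite lee_fin f0.
by rewrite -[leRHS]mule1 lee_wpmul2l ?lee_fin ?f1 ?g0.
Qed.

Lemma finite_meet_nu_star_le1 V E :
  (forall X, finite_set X -> X `<=` E -> exists2 v, V v & forall e, X e -> e v) ->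
  (nu_star R V E <= 1)%E.
Proof.
move=> common; apply: ge_ereal_sup => _ [f [f0 f1] <-].
apply: ge_ereal_sup => _ [X [finX XE] <-].
have [v Vv Xv] := common X finX XE; apply: le_trans (f1 v Vv).
by apply: esum_ge; exists X => //; split=> // e Xe; split; [exact: XE|exact: Xv].
Qed.

Lemma finite_escape_tau_star V E : is_hypergraph V E ->
  (forall D, finite_set D -> D `<=` V -> exists2 e, E e & D `&` e = set0) ->
  tau_star R V E = +oo%E.
Proof.
move=> EV escape; apply/eqP; rewrite -leye_eq.
apply: le_ereal_inf_tmp => _ [g [g0 g1] <-].
rewrite leye_eq; apply/negPn/negP => size_neq.
have gE0 v : V v -> (0 <= (g v)%:E)%E by rewrite lee_fin; exact: g0.
have size_fin : (frac_cover_size V g : \bar R) \is a fin_num.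
  by rewrite ge0_fin_numE ?ltey// esum_ge0.
have [_ [D [finD DV] <-] Dsize] := ub_ereal_sup_adherent ltr01 size_fin.
have [e Ee De] := escape D finD DV.
have eV := EV e Ee.
have : (\sum_(v \in D) (g v)%:E + 1 <= frac_cover_size V g)%E.
  rewrite /frac_cover_size (esumID e)// setIidr// addeC leeD ?g1//.
  apply: esum_ge; exists D => //; split=> // v Dv; split; first exact: DV.
  by move=> ev; have : (D `&` e) v by []; rewrite De.
by rewrite leNgt -lteBlDr// Dsize.
Qed.

Lemma nu_star_lt_heavy_vertex V E (J : finType) (e : J -> set T) w c :
  (nu_star R V E < c%:E)%E -> (forall j, E (e j)) -> convex_weights w ->
  exists2 v, V v & c^-1 < \sum_j w j * \1_(e j) v.
Proof.
move=> nu_c Ee [w0 w1].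
have c0 : 0 < c by have := le_lt_trans (nu_star_ge0 V E) nu_c; rewrite lte_fin.
apply: contrapT => small; suff : (c%:E <= nu_star R V E)%E by rewrite leNgt nu_c.
pose f x : R := c * \sum_j w j * freq R [:: e j] [set x].
have f_mass A : (\esum_(x in A) (f x)%:E = (c * \sum_j w j * \1_A (e j))%:E)%E.
  rewrite (esum_mixture_freq _ _ w0 (ltW c0)); congr (_ * _)%:E.
  by apply: eq_bigr => j _; rewrite /freq /mean big_seq1 divr1.
apply: ereal_sup_ubound; exists f; last first.
  rewrite /frac_matching_size f_mass; congr EFin; rewrite -[RHS]mulr1 -w1.
  by congr (_ * _); apply: eq_bigr => j _; rewrite indicE mem_set ?mulr1.
split=> [x _|v Vv].
  by rewrite mulr_ge0 ?sumr_ge0 ?(ltW c0)// => j _; rewrite mulr_ge0 ?freq_ge0.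
rewrite f_mass lee_fin -ler_pdivlMl// mulr1 leNgt; apply/negP => big.
apply: small; exists v => //; apply: lt_le_trans big _; apply: ler_sum => j _.
rewrite ler_wpM2l// !indicE.
by have [/set_mem[_ ev]|//] := boolP (e j \in _); rewrite mem_set.
Qed.

Lemma lt_tau_star_light_edge V E (J : finType) (s : J -> seq T) w c :
  0 < c -> (c%:E < tau_star R V E)%E -> convex_weights w ->
  exists2 e, E e & \sum_j w j * freq R (s j) e < c^-1.
Proof.
move=> c0 c_tau [w0 w1]; apply: contrapT => covers.
pose g v : R := c * \sum_j w j * freq R (s j) [set v].
have g_mass A : (\esum_(v in A) (g v)%:E = (c * \sum_j w j * freq R (s j) A)%:E)%E.
  by rewrite esum_mixture_freq// ltW.
suff : (tau_star R V E <= c%:E)%E by rewrite leNgt c_tau.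
apply: le_trans (ereal_inf_lbound (_ : _ (frac_cover_size V g))) _.
  exists g => //; split=> [v _|e Ee].
    by rewrite mulr_ge0 ?sumr_ge0 ?(ltW c0)// => j _; rewrite mulr_ge0 ?freq_ge0.
  rewrite g_mass lee_fin -ler_pdivrMl// mulr1 leNgt; apply/negP => lt.
  by apply: covers; exists e.
rewrite /frac_cover_size g_mass lee_fin -[leRHS]mulr1 ler_pM2l// -w1.
by apply: ler_sum => j _; rewrite ler_piMr ?freq_le1.
Qed.

Lemma finite_edges_cover V E c (L : seq (set T)) :
  (nu_star R V E < c%:E)%E -> [set` L] `<=` E ->
  exists2 s, [set` s] `<=` V & forall e, e \in L -> c^-1 <= freq R s e.
Proof.
case: L => [|e0 L0] nu_c; first by exists [::].
set L := e0 :: L0 => LE; have [c' nu_c' c'c] := lte_fin_between nu_c.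
have c'0 : 0 < c' by have := le_lt_trans (nu_star_ge0 V E) nu_c'; rewrite lte_fin.
have eE (j : 'I_(size L)) : E (tnth (in_tuple L) j) by apply/LE/mem_tnth.
have value w : convex_weights w ->
    exists2 v, V v & c'^-1 <= \sum_j w j * \1_(tnth (in_tuple L) j) v.
  by case/(nu_star_lt_heavy_vertex nu_c' eE) => v Vv /ltW; exists v.
have indic_bounded v (j : 'I_(size L)) :
    V v -> `|\1_(tnth (in_tuple L) j) v| <= 1 :> R.
  by rewrite indicE normr_nat lern1 leq_b1.
have [|s [_ sV s_ge]] :=
  approx_minimax ord0 indic_bounded value (_ : 0 < c'^-1 - c^-1).
  by rewrite subr_gt0 ltf_pV2// posrE (lt_trans c'0).
by exists s => // e /(tnthP (in_tuple L))[j ->]; have := s_ge j; rewrite subKr.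
Qed.

End Duality.

Section Tail.
Variables (R : realType) (T : choiceType) (V : set T) (E : set (set T)).
Hypothesis tailVE : iso_tail V E.

Lemma iso_tail_hypergraph : is_hypergraph V E.
Proof. by have [rank [_ [EV _]]] := tailVE; exact: EV. Qed.

Lemma iso_tail_nu_star_le1 : (nu_star R V E <= 1)%E.
Proof.
have [rank [[_ rank_inj rank_surj] [EV [Etail _]]]] := tailVE.
have /choice[start startP] e : exists j, E e -> rank @` e = tail_edge j.
  by have [/Etail[j ej]|] := pselect (E e); [exists j|exists 0%N].
apply: finite_meet_nu_star_le1 => X finX XE.
have [N start_lt] := finite_set_nat_ub start finX.
have [v Vv rank_v] := rank_surj N I; exists v => // e Xe.
have Ee := XE e Xe.
have [u eu rank_u] : (rank @` e) N.
  by rewrite startP// /tail_edge/= ltnW// start_lt.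
suff -> : v = u by [].
by apply: rank_inj; rewrite ?inE ?rank_v//; exact: EV eu.
Qed.

Lemma iso_tail_tau_star : tau_star R V E = +oo%E.
Proof.
have [rank [_ [_ [_ tailE]]]] := tailVE.
apply: finite_escape_tau_star iso_tail_hypergraph _ => D finD _.
have [N rank_lt] := finite_set_nat_ub rank finD; have [e [Ee eN]] := tailE N.
exists e => //; apply/seteqP; split=> // v [/rank_lt + ev].
have : (rank @` e) (rank v) by exists v.
by rewrite eN /tail_edge/= leqNgt => /negP.
Qed.

End Tail.

Lemma light_edges_ultrafilter (R : realType) (T : choiceType) (V : set T)
    (E : set (set T)) (s : nat -> seq T) (c theta : R) :
  0 < c -> (c%:E < tau_star R V E)%E -> c^-1 < theta ->
  exists2 U : set_system (set T), UltraFilter U &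
    infinitely_often (fun j => U [set e | E e /\ freq R (s j) e < theta]).
Proof.
move=> c0 c_tau c_theta; pose eps := (theta - c^-1) / 2.
have eps0 : 0 < eps by rewrite divr_gt0 ?subr_gt0.
have theta0 : 0 < theta by apply: lt_trans c_theta; rewrite invr_gt0.
pose small i := [set e | E e /\ freq R (s i) e < theta].
have /choice[t t_small] n : exists t : seq (set T), forall i, (i <= n)%N ->
    1 - (c^-1 + eps) / theta <= freq R t (small i).
  have value (w : 'I_n.+1 -> R) : convex_weights w ->
      exists2 e, E e & - c^-1 <= \sum_i w i * - freq R (s i) e.
    case/(lt_tau_star_light_edge (fun i : 'I_n.+1 => s i) c0 c_tau) => e Ee /ltW.
    by exists e => //; under eq_bigr do rewrite mulrN; rewrite sumrN lerN2.
  have freq_bounded e (i : 'I_n.+1) : E e -> `|- freq R (s i) e| <= 1.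
    by rewrite normrN ger0_norm ?freq_ge0 ?freq_le1.
  have [t [t0 tE t_ge]] := approx_minimax ord0 freq_bounded value eps0.
  exists t => i; rewrite -ltnS => i_n; rewrite /small.
  have -> : [set e | E e /\ freq R (s i) e < theta] =
      [set e | freq R (s i) e < theta] `&` E by apply/seteqP; split=> e [].
  rewrite freqI_supp//.
  apply: le_trans (markov_freq t0 theta0 (freq_ge0 R (s i))); rewrite lerD2l lerN2.
  rewrite ler_pM2r ?invr_gt0//; have := t_ge (Ordinal i_n).
  by rewrite meanN -opprD lerN2.
apply: (charges_ultrafilter (fun n => freq_charge R (t n)) _
  (fun i n => t_small n i)).
by rewrite subr_gt0 ltr_pdivrMr// mul1r /eps; lra.
Qed.

Lemma duality_gap_has_tail (R : realType) (T : choiceType) (V : set T)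
    (E : set (set T)) :
  (nu_star R V E < tau_star R V E)%E -> has_tail V E.
Proof.
move=> /lte_fin_between[c nu_c /lte_fin_between[c' c_c' c'_tau]].
rewrite lte_fin in c_c'.
have c0 : 0 < c by have := le_lt_trans (nu_star_ge0 R V E) nu_c; rewrite lte_fin.
have c'0 : 0 < c' by apply: lt_trans c_c'.
pose theta := (c'^-1 + c^-1) / 2.
have [c'_theta theta_c] : c'^-1 < theta /\ theta < c^-1.
  by split; rewrite midf_lt// ltf_pV2.
have [s sV s_covers] :=
  trace_adapted_sequence (fun L LE => finite_edges_cover nu_c LE).
have [U UU [j j_ge Uj]] := light_edges_ultrafilter s c'0 c'_tau c'_theta.
pose S := ultralimit_set U.
have /choice[e eP] n : exists e, [/\ E e, agree_on (flatten (mkseq s n)) e S &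
    forall i, (n <= i)%N -> c^-1 <= freq R (s i) e].
  have [e [[Ee _] eS]] :=
    filter_ex (filterI (Uj 0%N) (ultra_agree_on (flatten (mkseq s n)) UU)).
  have [e' [Ee' ee' e'_covered]] := s_covers n e Ee.
  by exists e'; split=> //; rewrite /agree_on -ee'.
have S_small n : freq R (s (j n)) S <= theta.
  have [e' [[_ e'_small] e'S]] :=
    filter_ex (filterI (Uj n) (ultra_agree_on (s (j n)) UU)).
  by rewrite -(freqI_supp _ S (fun=> id)) -e'S freqI_supp// ltW.
have eS n : agree_on (flatten (mkseq s n)) (e n) S by have [] := eP n.
have e_covered n i : (n <= i)%N -> c^-1 <= freq R (s i) (e n).
  by have [_ _] := eP n; apply.
have [v [i [Vv ev]]] :=
  escaping_mass_half_graph theta_c sV eS e_covered j_ge S_small.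
by apply: (half_graph_has_tail Vv _ ev) => n; have [] := eP (i n).
Qed.

Theorem theorem4p7 (R : realType) (T : choiceType) (V : set T) (E : set (set T)) :
  is_hypergraph V E ->
  ((forall (V' : set T) (E' : set (set T)), partial_sub V E V' E' ->
       nu_star R V' E' = tau_star R V' E') <->
   ~ (exists (V' : set T) (E' : set (set T)), partial_sub V E V' E' /\ iso_tail V' E')).
Proof.
move=> _; split=> [dual [V' [E' [sub tail]]]|no_tail V' E' sub].
  have := iso_tail_nu_star_le1 R tail.
  by rewrite (dual _ _ sub) (iso_tail_tau_star R tail) leye_eq.
have hypVE' := partial_sub_hypergraph sub.
apply/eqP; rewrite eq_le nu_star_le_tau_star//= leNgt; apply/negP.
move=> /duality_gap_has_tail[V'' [E'' [sub' tail]]].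
by apply: no_tail; exists V'', E''; split=> //; exact: partial_sub_trans sub sub'.
Qed.
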